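(* Let $(X,T)$ be a minimal system. Then $(X,T)$ is broken $\mathcal{F}_{inf}$-sensitive if and only if it is not an asymptotic extension of its maximal equicontinuous factor.
   Context: A (topological dynamical) system $(X,T)$ is a compact metric space $X$ with metric $d$ and a continuous surjective map $T\colon X\to X$; it is minimal if it has no proper non-empty closed $T$-invariant subset. $\mathbb{Z}_+=\{0,1,2,\dots\}$, $\mathbb{N}=\{1,2,\dots\}$. ''Opene'' means non-empty open. $\mathcal{F}_{inf}$ is the family of infinite subsets of $\mathbb{Z}_+$. For a family $\mathcal{F}$ of subsets of $\mathbb{Z}_+$, $(X,T)$ is broken $\mathcal{F}$-sensitive (i.e. broken $\mathcal{F}$-$2$-sensitive) if there exist $\delta>0$ and $F\in\mathcal{F}$ such that for every opene $U\subset X$ and every $l\in\mathbb{N}$ there exist $x_1^l,x_2^l\in U$ and $m_l\in\mathbb{Z}_+$ with $d(T^kx_1^l,T^kx_2^l)>\delta$ for all $k\in m_l+(F\cap[1,l])$. A factor map $\pi\colon(X,T)\to(Y,S)$ is a continuous surjection with $\pi\circ T=S\circ\pi$. A system is equicontinuous if for every $\varepsilon>0$ there is $\delta>0$ such that $d(x,y)<\delta$ implies $d(T^mx,T^my)<\varepsilon$ for all $m\in\mathbb{N}$. The maximal equicontinuous factor $(X_{eq},T_{eq})$ is the equicontinuous factor of $(X,T)$ such that every equicontinuous factor of $(X,T)$ is a factor of it; it is the quotient of $X$ by the smallest closed $T\times T$-invariant equivalence relation with equicontinuous quotient, and $\pi\colon X\to X_{eq}$ denotes the quotient map. A pair $(x_1,x_2)$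 is asymptotic if $\lim_{m\to\infty}d(T^mx_1,T^mx_2)=0$. $(X,T)$ is an asymptotic extension of $(Y,S)$ via $\pi$ if every pair $(x_1,x_2)$ with $\pi(x_1)=\pi(x_2)$ is asymptotic. *)

(* Defs.v *)
From mathcomp Require Import all_boot all_order all_algebra.
From mathcomp Require Import all_classical all_reals.
From mathcomp Require Import topology normedtype.

Set Implicit Arguments.
Unset Strict Implicit.
Unset Printing Implicit Defensive.

Import Order.TTheory GRing.Theory Num.Theory.
Import numFieldNormedType.Exports.

Local Open Scope classical_set_scope.
Local Open Scope ring_scope.

(* Systems are nonempty: on the empty space, minimality and broken sensitivity
   would both hold vacuously. *)
Definition is_system (R : realType) (X : metricType R) (T : X -> X) : Prop :=
  [/\ [set: X] !=set0, compact [set: X], continuous T & range T = [set: X]].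

Definition minimal_system (R : realType) (X : metricType R) (T : X -> X) :
    Prop :=
  is_system T /\
  forall A : set X, closed A -> T @` A `<=` A -> A !=set0 -> A = [set: X].

Definition infinite_family : set (set nat) := [set F | infinite_set F].

(* k ranges over m + (F `&` [1, l]), that is, k = m + j with j in F, 1 <= j <= l *)
Definition broken_sensitive (R : realType) (X : metricType R) (T : X -> X)
    (Fam : set (set nat)) : Prop :=
  exists (delta : R) (F : set nat), [/\ 0 < delta, Fam F &
    forall U : set X, open U -> U !=set0 -> forall l : nat, (0 < l)%N ->
    exists (x1 x2 : X) (m : nat), [/\ U x1, U x2 &
      forall j : nat, F j -> (1 <= j <= l)%N ->
        delta < mdist (iter (m + j) T x1) (iter (m + j) T x2)]].

Definition factor_map (R : realType) (X Y : metricType R)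
    (T : X -> X) (S : Y -> Y) (p : X -> Y) : Prop :=
  [/\ continuous p, range p = [set: Y] & p \o T = S \o p].

(* Unlike the library's pointwise [equicontinuous], delta is uniform in x. *)
Definition equicontinuous_system (R : realType) (X : metricType R)
    (T : X -> X) : Prop :=
  forall eps : R, 0 < eps -> exists2 delta : R, 0 < delta &
    forall x y : X, mdist x y < delta ->
    forall m : nat, (0 < m)%N -> mdist (iter m T x) (iter m T y) < eps.

Definition equicontinuous_factor (R : realType) (X Y : metricType R)
    (T : X -> X) (S : Y -> Y) (p : X -> Y) : Prop :=
  [/\ is_system S, equicontinuous_system S & factor_map T S p].

(* Universal property: every equicontinuous factor of (X, T) is a factor of
   (Y, S) compatibly with the maps from X.  Equivalently, p is, up to
   isomorphism, the quotient of X by the smallest closed invariant equivalence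
   relation whose quotient is equicontinuous. *)
Definition maximal_equicontinuous_factor (R : realType) (X Y : metricType R)
    (T : X -> X) (S : Y -> Y) (p : X -> Y) : Prop :=
  equicontinuous_factor T S p /\
  forall (Z : metricType R) (Q : Z -> Z) (q : X -> Z),
    equicontinuous_factor T Q q ->
    exists2 r : Y -> Z, factor_map S Q r & q = r \o p.

Definition asymptotic_pair (R : realType) (X : metricType R) (T : X -> X)
    (x1 x2 : X) : Prop :=
  mdist (iter m T x1) (iter m T x2) @[m --> \oo] --> (0 : R).

Definition asymptotic_extension (R : realType) (X Y : metricType R)
    (T : X -> X) (p : X -> Y) : Prop :=
  forall x1 x2 : X, p x1 = p x2 -> asymptotic_pair T x1 x2.

(* Main.v *)
From HB Require Import structures.
Require Import Defs.
From mathcomp Require Import all_boot all_order all_algebra.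
From mathcomp Require Import all_classical all_reals.
From mathcomp Require Import interval_inference topology normedtype sequences.
From mathcomp Require Import lra.

Set Implicit Arguments.
Unset Strict Implicit.
Unset Printing Implicit Defensive.

Import Order.TTheory GRing.Theory Num.Theory.
Import numFieldNormedType.Exports.

Local Open Scope classical_set_scope.
Local Open Scope ring_scope.

(** Let pi be the quotient map to the maximal equicontinuous factor.

    If every pi-fibre consists of asymptotic pairs, then the system is not
    broken sensitive: apply the sensitivity condition to smaller and smaller
    neighbourhoods of one point, with longer and longer pieces of F.  The
    separated pairs come from nearby points, so equicontinuity keeps their
    pi-images close at all times; a cluster point of these pairs lies in one
    fibre and stays delta-apart along the whole infinite set F, hence is not
    asymptotic ([broken_sensitive_not_asymptotic]).

    Conversely let pi x = pi y with (x, y) not asymptotic, so that the two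
    orbits are e-apart along an infinite set F.  It is enough to find, in every
    nonempty open set U, two points that some iterate of T carries as close as
    desired to x and y.  In other words (x, y) must belong to the closure N of
    the union of the sets (T x T)^n (U x U)
    ([fiber_pair_in_square_orbit_closure]).  The proof follows an idea of
    McMahon: measure the fibres N(z) = {w | (z, w) in N} of that closed
    invariant set.

    Let m be an invariant mean of T and mu K the infimum of m over the open
    sets that contain K.  The function z |-> mu N(z) is upper semicontinuous and
    does not decrease along orbits, so minimality makes it constant.  From this
    d(x, y) = mu (N(x) :|: N(y)) - mu N(x) is a T-invariant continuous
    pseudodistance: upper semicontinuity gives continuity, submodularity of mu
    the triangle inequality.  The metric quotient X / d is an isometric, hence
    equicontinuous, factor, so d vanishes on the fibres of pi
    ([maximal_factor_collapses]).  Thus N(x) and N(y) have the same mu-content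
    as their union.  Now y = T^k u for some u in U, so that N(y) contains
    T^k U; pieces of T^k U arbitrarily close to y have positive content because
    nonempty open sets do.  Such a piece cannot miss the closed set N(x)
    ([fiber_dist0_meet]), whence y is in N(x).

    The mean m is finitely additive and defined on all sets, as an ultrafilter
    limit of visit frequencies along one orbit; the link with the topology is
    made by the outer regularization mu. *)

(** * Continuity of iterates and distances *)

Lemma continuous_iter (X : topologicalType) (T : X -> X) (n : nat) :
  continuous T -> continuous (iter n T).
Proof.
move=> Tc; elim: n => [|n IHn] x; first exact: cvg_id.
exact: (continuous_comp (IHn x) (@Tc _)).
Qed.

Lemma continuous_mdist (R : realType) (X : topologicalType) (Z : metricType R)
    (f g : X -> Z) : continuous f -> continuous g ->
  continuous (fun x => mdist (f x) (g x) : R).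
Proof.
move=> fc gc x; apply/cvgrPdist_lt => e e0.
have e20 : 0 < e / 2 by rewrite divr_gt0.
have /metricType_numDomainType.cvgrPdist_lt/(_ _ e20) fx := fc x.
have /metricType_numDomainType.cvgrPdist_lt/(_ _ e20) gx := gc x.
apply: filterS2 fx gx => y fxy gxy; rewrite ltr_distlC.
have := metric_triangle (f x) (f y) (g x).
have := metric_triangle (f y) (g y) (g x).
have := metric_triangle (f y) (f x) (g y).
have := metric_triangle (f x) (g x) (g y).
rewrite (metric_sym (f y) (f x)) (metric_sym (g y) (g x)).
by move=> *; apply/andP; split; lra.
Qed.

Lemma continuous_mdist_pair (R : realType) (X Y : topologicalType)
    (Z : metricType R) (f : X -> Z) (g : Y -> Z) :
  continuous f -> continuous g ->
  continuous (fun z : X * Y => mdist (f z.1) (g z.2) : R).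
Proof.
move=> fc gc; apply: continuous_mdist => z.
  by apply: (continuous_comp cvg_fst); exact: fc.
by apply: (continuous_comp cvg_snd); exact: gc.
Qed.

(** * Invariant means *)

(** Modularity on all pairs, together with [m set0 = 0], is finite additivity. *)
Definition invariant_charge (R : realType) (A : Type) (T : A -> A)
    (m : set A -> R) : Prop :=
  [/\ m [set: A] = 1, m set0 = 0, (forall E, 0 <= m E),
      (forall E F, m (E `|` F) + m (E `&` F) = m E + m F) &
      forall E, m (T @^-1` E) = m E].

Definition visit_frequency (R : realType) (A : Type) (T : A -> A) (a : A)
    (E : set A) (n : nat) : R :=
  (\sum_(k < n.+1) (iter k T a \in E)%:R) / n.+1%:R.

Section visit_frequency.
Context {R : realType} {A : Type} (T : A -> A) (a : A).
Local Notation freq := (@visit_frequency R A T a).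

Lemma visit_frequency_itv (E : set A) (n : nat) : freq E n \in `[0, 1].
Proof.
rewrite in_itv /= /visit_frequency; apply/andP; split.
  by apply: divr_ge0 => //; apply: sumr_ge0 => i _; rewrite ler0n.
rewrite ler_pdivrMr ?ltr0n// mul1r.
rewrite -[leRHS](_ : \sum_(k < n.+1) 1 = _); last first.
  by rewrite sumr_const card_ord.
by apply: ler_sum => i _; rewrite lern1 leq_b1.
Qed.

Lemma visit_frequencyT n : freq [set: A] n = 1.
Proof.
rewrite /visit_frequency (eq_bigr (fun=> 1)).
  by rewrite sumr_const card_ord divff// pnatr_eq0.
by move=> i _; rewrite in_setT.
Qed.

Lemma visit_frequency0 n : freq set0 n = 0.
Proof.
by rewrite /visit_frequency big1 ?mul0r// => i _; rewrite in_set0.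
Qed.

Lemma visit_frequencyU E F n :
  freq (E `|` F) n + freq (E `&` F) n = freq E n + freq F n.
Proof.
rewrite /visit_frequency -!mulrDl -!big_split /=; congr (_ / _).
apply: eq_bigr => i _; rewrite in_setU in_setI.
by case: (_ \in E); case: (_ \in F); rewrite /= ?addr0 ?add0r.
Qed.

(** The two sums over the orbit segment differ in their end terms only. *)
Lemma visit_frequency_shift E n :
  `|freq (T @^-1` E) n - freq E n| <= harmonic n.
Proof.
rewrite /visit_frequency -mulrBl normrM normfV (ger0_norm (ler0n _ n.+1)).
rewrite ler_piMl ?invr_ge0// [X in _ - X]big_ord_recl big_ord_recr /=.
rewrite (eq_bigr (fun i : 'I_n => (iter (bump 0 i) T a \in E)%:R : R));
  last first.
  by move=> i _; congr (_%:R); rewrite !inE.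
rewrite [X in X - _]addrC opprD addrA addrAC addrK.
rewrite -[_ \in T @^-1` E]/(_ \in _).
by case: (_ \in _); case: (_ \in _);
  rewrite ?subrr ?subr0 ?sub0r ?normrN ?normr0 ?normr1.
Qed.
End visit_frequency.

(** Visit frequencies lie in the compact interval [0, 1], so along an
    ultrafilter finer than the one at infinity they all converge at once, and
    the limit inherits every linear relation that holds asymptotically. *)
Lemma invariant_charge_exists (R : realType) (A : Type) (T : A -> A) (a : A) :
  exists m : set A -> R, invariant_charge T m.
Proof.
have [G [GU ooG]] := @ultraFilterLemma nat \oo _.
pose f := @visit_frequency R A T a.
have fG (E : set A) : exists l : R, f E n @[n --> G] --> l.
  have := @segment_compact R 0 1; rewrite compact_ultra.
  have fGU : UltraFilter (f E n @[n --> G]).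
    split; first exact: fmap_proper_filter.
    move=> H HF sub; apply/seteqP; split=> // B HB; rewrite /= /nbhs /=.
    have [//|GC] := in_ultra_setVsetC (f E @^-1` B) GU.
    suff : H set0 by move=> /filter_not_empty.
    by rewrite -(setICr B); apply: filterI => //; exact: sub.
  move=> /(_ _ fGU)[|l [_ fl]]; last by exists l.
  suff : G (f E @^-1` [set` `[0, 1]]) by [].
  by apply: filterE => n; exact: (@visit_frequency_itv R A T a).
pose m E := sval (cid (fG E)).
have mP E : f E n @[n --> G] --> m E by exact: (svalP (cid (fG E))).
have uniq (u : nat -> R) (l l' : R) :
    u n @[n --> G] --> l -> u n @[n --> G] --> l' -> l = l'.
  by move=> ul ul'; apply: (cvg_unique _ ul ul'); exact: norm_hausdorff.
exists m; split.
- apply: (uniq _ _ _ (mP _)); apply: cvg_near_cst; apply: filterE => n.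
  exact: visit_frequencyT.
- apply: (uniq _ _ _ (mP _)); apply: cvg_near_cst; apply: filterE => n.
  exact: visit_frequency0.
- move=> E; apply: (cvgr_to_ge (mP E)); apply: filterE => n.
  by have := @visit_frequency_itv R A T a E n; rewrite in_itv /= => /andP[].
- move=> E F; apply: (uniq _ _ _ (cvgD (mP _) (mP _))).
  apply: cvg_trans (cvgD (mP E) (mP F)); apply: near_eq_cvg.
  by apply: filterE => n; rewrite visit_frequencyU.
- move=> E; apply/subr0_eq; apply: (uniq _ _ _ (cvgB (mP _) (mP _))).
  apply: norm_cvg0; apply: (@squeeze_cvgr _ _ _ _ (fun=> 0) (@harmonic R)).
  + by apply: filterE => n; rewrite normr_ge0 /=; exact: visit_frequency_shift.
  + exact: cvg_cst.
  + exact: (cvg_trans (cvg_app _ ooG) cvg_harmonic).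
Qed.

Section invariant_charge_theory.
Context {R : realType} {A : Type} {T : A -> A} {m : set A -> R}.
Hypothesis mT : invariant_charge T m.

Lemma charge_ge0 E : 0 <= m E.
Proof. by case: mT. Qed.

Lemma chargeU E F : m (E `|` F) + m (E `&` F) = m E + m F.
Proof. by case: mT. Qed.

Lemma charge_preimage E : m (T @^-1` E) = m E.
Proof. by case: mT. Qed.

Lemma le_charge (E F : set A) : E `<=` F -> m E <= m F.
Proof.
move=> EF; have := chargeU E (F `\` E).
rewrite setDUK// setDE setICA setICr setI0.
case: (mT) => _ -> _ _ _; rewrite addr0 => ->.
by rewrite lerDl charge_ge0.
Qed.

Lemma charge_iter_preimage n E : m (iter n T @^-1` E) = m E.
Proof.
elim: n E => // n IHn E.
by rewrite -[RHS]charge_preimage -(IHn (T @^-1` E)).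
Qed.

Lemma charge_visits_before n E :
  m [set x | exists2 j, (j < n)%N & E (iter j T x)] <= n%:R * m E.
Proof.
elim: n => [|n IHn].
  rewrite mul0r [X in m X](_ : _ = set0); last by rewrite -subset0 => x [].
  by case: mT => _ ->.
have /le_charge : [set x | exists2 j, (j < n.+1)%N & E (iter j T x)] `<=`
    [set x | exists2 j, (j < n)%N & E (iter j T x)] `|` iter n T @^-1` E.
  move=> x [j]; rewrite ltnS leq_eqVlt => /predU1P[->|jn] Ej; first by right.
  by left; exists j.
move=> /le_trans; apply; rewrite -addn1 natrD mulrDl mul1r.
rewrite -[X in _ + X](charge_iter_preimage n).
apply: le_trans (lerD IHn (lexx _)); rewrite -chargeU lerDl.
exact: charge_ge0.
Qed.
End invariant_charge_theory.

(** * Minimal systems *)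

Section minimal_systems.
Context {R : realType} {X : metricType R} {T : X -> X}.
Hypothesis Tmin : minimal_system T.

Let Xcompact : compact [set: X]. Proof. by case: Tmin => -[]. Qed.
Let Tcts : continuous T. Proof. by case: Tmin => -[]. Qed.
Let Tsurj : range T = [set: X]. Proof. by case: Tmin => -[]. Qed.

Lemma minimal_iter_surjective n x : exists y, iter n T y = x.
Proof.
elim: n x => [|n IHn] x; first by exists x.
have : [set: X] x by [].
rewrite -Tsurj => -[z _ <-]; have [y <-] := IHn z.
by exists y.
Qed.

(** Points that never visit [U] form a closed invariant set, which minimality
    makes empty; compactness then bounds the waiting time. *)
Lemma minimal_visits_bounded (U : set X) : open U -> U !=set0 ->
  exists n, forall x, exists2 j, (j < n)%N & U (iter j T x).
Proof.
move=> Uo [u Uu].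
have Uvisited x : exists j, U (iter j T x).
  apply: contrapT => /forallNP xU.
  have [_ /(_ [set y | forall j, ~ U (iter j T y)])] := Tmin.
  have -> : [set y | forall j, ~ U (iter j T y)] =
      \bigcap_j (iter j T @^-1` (~` U)).
    by apply/seteqP; split=> y yU j; [move=> _; exact: yU|exact: yU].
  set D := \bigcap_j _ => Dfull; suff : D u by move=> /(_ 0%N I).
  rewrite Dfull//.
  - apply: closed_bigI => j _; apply: preimage_closed (open_closedC Uo).
    by move=> y _; exact: continuous_iter.
  - by move=> _ [y yD <-] j _; rewrite /preimage /= -iterSr; exact: (yD j.+1).
  - by exists x => j _; exact: xU.
have := (compact_near_coveringP [set: X]).1 Xcompact nat \oo
  (fun n x => exists2 j, (j < n)%N & U (iter j T x)).
case=> [x _|n _ nX].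
- have [j Uj] := Uvisited x.
  exists (iter j T @^-1` U, [set n | (j < n)%N]) => /=.
    split; last by exists j.+1.
    by apply: (continuous_iter Tcts); exact: open_nbhs_nbhs.
  by move=> [y n] /= [Uy jn]; exists j.
- by exists n => x; apply: (nX n) => /=.
Qed.

(** Choose an [n]-th preimage of [x], with [n] a bound on the waiting time: its
    orbit meets [U] before it reaches [x]. *)
Lemma minimal_backward_orbit_meets (U : set X) x : open U -> U !=set0 ->
  exists u n, U u /\ iter n T u = x.
Proof.
move=> Uo U0; have [n nP] := minimal_visits_bounded Uo U0.
have [y <-] := minimal_iter_surjective n x.
have [j jn Uj] := nP y.
by exists (iter j T y), (n - j)%N; split => //; rewrite -iterD subnK// ltnW.
Qed.

(** Finitely many preimages of [U], all of the same charge, cover the space. *)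
Lemma minimal_charge_open_gt0 (m : set X -> R) (U : set X) :
  invariant_charge T m -> open U -> U !=set0 -> 0 < m U.
Proof.
move=> mT Uo U0; have [n nP] := minimal_visits_bounded Uo U0.
rewrite lt_neqAle (charge_ge0 mT) andbT; apply/eqP => mU0.
have := charge_visits_before mT n U.
rewrite -mU0 mulr0 [X in m X](_ : _ = [set: X]); last first.
  by apply/seteqP; split => // x _; exact: nP.
by case: (mT) => -> _ _ _ _; rewrite ler10.
Qed.
End minimal_systems.

(** * Outer regularization of a charge *)

Definition outer_charge (R : realType) (X : topologicalType) (m : set X -> R)
    (K : set X) : R :=
  inf [set m O | O in [set O | open O /\ K `<=` O]].

Section outer_charge.
Context {R : realType} {X : metricType R} {T : X -> X} {m : set X -> R}.
Hypothesis mT : invariant_charge T m.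
Local Notation mu := (outer_charge m).

Let values_ne K : [set m O | O in [set O | open O /\ K `<=` O]] !=set0.
Proof. by exists (m setT), setT => //; split; [exact: openT|]. Qed.

Lemma outer_charge_le K O : open O -> K `<=` O -> mu K <= m O.
Proof.
move=> Oo KO; apply: ge_inf; last by exists O.
by exists 0 => _ [E _ <-]; exact: (charge_ge0 mT).
Qed.

Lemma outer_charge_ge K c :
  (forall O, open O -> K `<=` O -> c <= m O) -> c <= mu K.
Proof. by move=> cK; apply: lb_le_inf => // _ [O [Oo KO] <-]; exact: cK. Qed.

Lemma outer_charge_lt K c : mu K < c ->
  exists O, [/\ open O, K `<=` O & m O < c].
Proof. by move=> /(inf_lt (values_ne K))[_ [O [Oo KO] <-] mOc]; exists O. Qed.

Lemma le_outer_charge K L : K `<=` L -> mu K <= mu L.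
Proof.
move=> KL; apply: outer_charge_ge => O Oo LO.
by apply: outer_charge_le => //; exact: subset_trans LO.
Qed.

(** Strong subadditivity.  It is the source of the triangle inequality for
    [fiber_dist], with a fibre [M] common to two unions of fibres. *)
Lemma outer_chargeU_le K L M : M `<=` K `&` L ->
  mu (K `|` L) + mu M <= mu K + mu L.
Proof.
move=> MKL; rewrite -lerBlDr; apply: outer_charge_ge => V Vo LV.
rewrite lerBlDr -lerBlDl; apply: outer_charge_ge => O Oo KO.
rewrite lerBlDl -(chargeU mT) lerD//.
  by apply: outer_charge_le; [exact: openU|exact: setUSS].
apply: outer_charge_le; [exact: openI|].
by apply: subset_trans MKL _; exact: setISS.
Qed.

Lemma outer_chargeU_ge K L O V : open O -> open V -> O `&` V = set0 ->
  K `<=` O -> L `<=` V -> mu K + mu L <= mu (K `|` L).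
Proof.
move=> Oo Vo OV KO LV; apply: outer_charge_ge => W Wo.
rewrite subUset => -[KW LW].
have WO : mu K <= m (W `&` O).
  by apply: outer_charge_le; [exact: openI|rewrite subsetI].
have WV : mu L <= m (W `&` V).
  by apply: outer_charge_le; [exact: openI|rewrite subsetI].
apply: le_trans (lerD WO WV) _.
rewrite -(chargeU mT) setIACA OV setI0 -setIUr.
have -> : m set0 = 0 by case: mT.
by rewrite addr0; apply: (le_charge mT); exact: subIsetl.
Qed.

(** For the nontrivial inequality, an open [O] containing the preimage of [K]
    contains the preimage of the complement of [T @` ~` O], which is an open set
    containing [K]. *)
Lemma outer_charge_preimage K : compact [set: X] -> continuous T ->
  mu (T @^-1` K) = mu K.
Proof.
move=> Xc Tc; apply/le_anti/andP; split; apply: outer_charge_ge => O Oo KO.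
  rewrite -(charge_preimage mT); apply: outer_charge_le.
    by apply: open_comp => // x _; exact: Tc.
  exact: preimage_subset.
pose V := ~` (T @` ~` O).
have Vo : open V.
  apply: closed_openC; apply: compact_closed; first exact: metric_hausdorff.
  apply: continuous_compact; first exact: continuous_subspaceT.
  by apply: subclosed_compact Xc _ => //; exact: open_closedC.
apply: (@le_trans _ _ (m V)).
  apply: outer_charge_le => // y Ky [x nOx Txy].
  by apply/nOx/KO; rewrite /= Txy.
rewrite -(charge_preimage mT); apply: (le_charge mT) => x Vx.
by apply: contrapT => nOx; apply: Vx; exists x.
Qed.
End outer_charge.

(** * The pseudodistance given by the fibres of an invariant closed relation *)

Lemma closed_fiber (X Y : topologicalType) (N : set (X * Y)) (x : X) :
  closed N -> closed [set y | N (x, y)].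
Proof.
move=> Ncl; have -> : [set y | N (x, y)] = pair x @^-1` N by [].
apply: preimage_closed Ncl => y _.
by apply: cvg_pair; [exact: cvg_cst|exact: cvg_id].
Qed.

Section fiber_pseudodistance.
Context {R : realType} {X : metricType R} {T : X -> X} {m : set X -> R}.
Hypotheses (Tmin : minimal_system T) (mT : invariant_charge T m).
Variable N : set (X * X).
Hypotheses (Ncl : closed N) (NT : forall x y, N (x, y) -> N (T x, T y)).
Local Notation mu := (outer_charge m).
Local Notation fib x := [set y | N (x, y)].

Let Xcompact : compact [set: X]. Proof. by case: Tmin => -[]. Qed.
Let Tcts : continuous T. Proof. by case: Tmin => -[]. Qed.

(** Tube lemma, by compactness of the complement of [O]. *)
Lemma fiber_usc x O : open O -> fib x `<=` O ->
  \forall x' \near x, fib x' `<=` O.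
Proof.
move=> Oo xO.
have nOc : compact (~` O).
  by apply: subclosed_compact Xcompact _ => //; exact: open_closedC.
have near_nN y : (~` O) y -> \forall y' \near y & x' \near x, ~ N (x', y').
  move=> nOy; have nNo : nbhs (x, y) (~` N).
    apply: open_nbhs_nbhs; split; first exact: closed_openC.
    by move=> /xO.
  case: nNo => -[U V] /= [xU yV] UV; exists (V, U) => // -[y' x'] /= [Vy' Ux'].
  exact: (UV (x', y')).
have := (compact_near_coveringP _).1 nOc X (nbhs x)
  (fun x' y => ~ N (x', y)) (nbhs_filter x) near_nN.
apply: filterS => x' x'O y x'y.
by apply: contrapT => nOy; exact: (x'O y nOy).
Qed.

Lemma fiber_charge_le x : mu (fib x) <= mu (fib (T x)).
Proof.
rewrite -(outer_charge_preimage mT (fib (T x)) Xcompact Tcts).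
by apply: (le_outer_charge mT) => y; exact: NT.
Qed.

(** By upper semicontinuity the points where the content of the fibre is below
    [mu (fib v) + e] form a neighbourhood of [v]; the orbit of [u] visits it,
    and the content has not decreased meanwhile. *)
Lemma fiber_charge_constant x y : mu (fib x) = mu (fib y).
Proof.
suff le_fib u v : mu (fib u) <= mu (fib v) by apply/le_anti; rewrite !le_fib.
apply/ler_addgt0Pr => e e0.
have [O [Oo vO mO]] :
    exists O, [/\ open O, fib v `<=` O & m O < mu (fib v) + e].
  by apply: outer_charge_lt; rewrite ltrDl.
have [|n /(_ u)[j _ /= jO]] :=
    minimal_visits_bounded Tmin (open_interior [set z | fib z `<=` O]).
  by exists v; exact: fiber_usc.
apply: le_trans (ltW mO).
apply: (@le_trans _ _ (mu (fib (iter j T u)))).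
  elim: j {jO} => //= j IHj; apply: le_trans IHj _; exact: fiber_charge_le.
by apply: (outer_charge_le mT) => //; exact: nbhs_singleton jO.
Qed.

(** As all fibres have equal content, this plays the part of half of the content
    of their symmetric difference. *)
Definition fiber_dist x y : R := mu (fib x `|` fib y) - mu (fib x).

Lemma fiber_distxx x : fiber_dist x x = 0.
Proof. by rewrite /fiber_dist setUid subrr. Qed.

Lemma fiber_dist_sym x y : fiber_dist x y = fiber_dist y x.
Proof. by rewrite /fiber_dist setUC (fiber_charge_constant x y). Qed.

Lemma fiber_dist_triangle y x z :
  fiber_dist x z <= fiber_dist x y + fiber_dist y z.
Proof.
rewrite /fiber_dist (fiber_charge_constant x y).
have ysub : fib y `<=` (fib x `|` fib y) `&` (fib z `|` fib y).
  by move=> w yw; split; right.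
have := outer_chargeU_le mT ysub.
rewrite setUACA setUid (setUC (fib z)).
have := le_outer_charge mT (@subsetUl _ (fib x `|` fib z) (fib y)).
lra.
Qed.

(** The fibre of [x] is contained in the preimage of the fibre of [T x] and has
    the same content, so either may replace the other in a union. *)
Lemma fiber_dist_shift x y : fiber_dist (T x) (T y) = fiber_dist x y.
Proof.
rewrite /fiber_dist (fiber_charge_constant (T x) x); congr (_ - _).
rewrite -(outer_charge_preimage mT (_ `|` fib (T y)) Xcompact Tcts).
rewrite preimage_setU.
set A' := T @^-1` fib (T x); set B' := T @^-1` fib (T y).
have AA' : fib x `<=` A' by move=> z; exact: NT.
have BB' : fib y `<=` B' by move=> z; exact: NT.
have mA' : mu A' = mu (fib x).
  by rewrite outer_charge_preimage// (fiber_charge_constant (T x) x).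
have mB' : mu B' = mu (fib y).
  by rewrite outer_charge_preimage// (fiber_charge_constant (T y) y).
apply/le_anti/andP; split; last by apply: (le_outer_charge mT); exact: setUSS.
have leA : mu (A' `|` B') <= mu (fib x `|` B').
  have xsub : fib x `<=` A' `&` (fib x `|` B').
    by move=> z xz; split; [exact: AA'|left].
  by have := outer_chargeU_le mT xsub; rewrite setUA (setUidl AA') mA'; lra.
have ysub : fib y `<=` B' `&` (fib x `|` fib y).
  by move=> z yz; split; [exact: BB'|right].
have := outer_chargeU_le mT ysub; rewrite setUCA (setUidl BB') mB'; lra.
Qed.

Lemma fiber_dist_continuous x (e : R) : 0 < e ->
  \forall y \near x, fiber_dist x y < e.
Proof.
move=> e0.
have [O [Oo xO mO]] :
    exists O, [/\ open O, fib x `<=` O & m O < mu (fib x) + e].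
  by apply: outer_charge_lt; rewrite ltrDl.
have := fiber_usc Oo xO; apply: filterS => y yO.
rewrite /fiber_dist ltrBlDl; apply: le_lt_trans mO.
by apply: (outer_charge_le mT) => //; rewrite subUset.
Qed.

(** A closed [K] disjoint from [fib y] is separated from it by open sets, so it
    would add its own content to that of [fib y]. *)
Lemma fiber_dist0_meet x y (K : set X) : fiber_dist x y = 0 ->
  closed K -> K `<=` fib x -> 0 < mu K -> K `&` fib y !=set0.
Proof.
move=> xy0 Kcl Kx mK; apply/set0P/eqP => Ky0.
have [U [V [Uo Vo KU yV UV]]] :=
  (@normal_openP R X).1 pseudometric_normal _ _ Kcl
    (closed_fiber (x := y) Ncl) Ky0.
have := outer_chargeU_ge mT Uo Vo UV KU yV.
have := le_outer_charge mT (@setSU _ (fib y) _ _ Kx).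
move: xy0; rewrite /fiber_dist (fiber_charge_constant x y); lra.
Qed.
End fiber_pseudodistance.

(** * The metric quotient by a pseudodistance *)

Record pseudodistance (R : realType) (X : Type) := Pseudodistance {
  psd :> X -> X -> R;
  psd_xx : forall x, psd x x = 0;
  psd_sym : forall x y, psd x y = psd y x;
  psd_triangle : forall y x z, psd x z <= psd x y + psd y z }.

Section pseudodistance_quotient.
Context {R : realType} {X : choiceType} (d : pseudodistance R X).

Lemma psd_eq0_congr x y : d x y = 0 -> forall z, d x z = d y z.
Proof.
move=> xy0 z; have := psd_triangle d x y z; have := psd_triangle d y x z.
by rewrite (psd_sym d y x) xy0; lra.
Qed.

Definition psd_repr (x : X) : X := choose (fun y => d x y == 0) x.

Lemma psd_repr_dist x : d x (psd_repr x) = 0.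
Proof. by apply/eqP/(@chooseP _ (fun y => d x y == 0)); rewrite psd_xx. Qed.

Lemma psd_repr_eq x y : (psd_repr x = psd_repr y) <-> (d x y = 0).
Proof.
split=> [xy|xy0]; last first.
  rewrite /psd_repr -(@eq_choose _ (fun z => d x z == 0)).
    by apply: choose_id; rewrite ?psd_xx// xy0.
  by move=> z; rewrite (psd_eq0_congr xy0).
rewrite -(psd_eq0_congr (etrans (psd_sym _ _ _) (psd_repr_dist x))).
by rewrite xy psd_sym psd_repr_dist.
Qed.

Lemma psd_repr_idem x : psd_repr (psd_repr x) == psd_repr x.
Proof. by apply/eqP/psd_repr_eq; rewrite psd_sym psd_repr_dist. Qed.

(** Canonical representatives stand for the classes.  The type is not given the
    topology induced from [X]: the pseudodistance defines its metric. *)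
Definition psd_quotient : Type := {x : X | psd_repr x == x}.

HB.instance Definition _ := Choice.copy psd_quotient {x : X | psd_repr x == x}.

Definition psd_class (x : X) : psd_quotient :=
  exist _ (psd_repr x) (psd_repr_idem x).

Definition quotient_dist (u v : psd_quotient) : R := d (val u) (val v).

Lemma quotient_dist_class x y :
  quotient_dist (psd_class x) (psd_class y) = d x y.
Proof.
rewrite /quotient_dist /=.
rewrite (psd_eq0_congr (etrans (psd_sym _ _ _) (psd_repr_dist x))) psd_sym.
rewrite (psd_eq0_congr (etrans (psd_sym _ _ _) (psd_repr_dist y))).
exact: psd_sym.
Qed.

Lemma psd_class_val u : psd_class (val u) = u.
Proof. by apply: val_inj; rewrite /=; exact/eqP/(valP u). Qed.

Lemma quotient_dist_eq0 u v : quotient_dist u v = 0 -> u = v.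
Proof.
rewrite -(psd_class_val u) -(psd_class_val v) quotient_dist_class.
by move=> /psd_repr_eq uv; apply: val_inj.
Qed.

HB.instance Definition _ := isMetric.Build R psd_quotient
  (fun u => psd_xx d (val u)) quotient_dist_eq0
  (fun u v => psd_sym d (val u) (val v))
  (fun v u w => psd_triangle d (val v) (val u) (val w)).

Lemma mdist_class x y : mdist (psd_class x) (psd_class y) = d x y.
Proof. exact: quotient_dist_class. Qed.

Lemma psd_class_eq x y : psd_class x = psd_class y <-> d x y = 0.
Proof.
split=> [xy|/psd_repr_eq xy]; last exact: val_inj.
by rewrite -mdist_class xy mdistxx.
Qed.
End pseudodistance_quotient.

Lemma isometry_continuous (R : realType) (X Y : metricType R) (f : X -> Y) :
  (forall x y, mdist (f x) (f y) = mdist x y :> R) -> continuous f.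
Proof.
move=> fiso x; apply/metricType_numDomainType.cvgrPdist_lt => e e0.
have : nbhs x (ball x e) by exact: nbhsx_ballx.
by apply: filterS => y; rewrite fiso ballEmdist.
Qed.

(** [T] induces an isometry of the quotient by [d], which is therefore an
    equicontinuous factor and so factors through [p]. *)
Lemma maximal_factor_collapses (R : realType) (X Y : metricType R) (T : X -> X)
    (S : Y -> Y) (p : X -> Y) (d : pseudodistance R X) :
  is_system T -> maximal_equicontinuous_factor T S p ->
  (forall x e, 0 < e -> \forall y \near x, d x y < e) ->
  (forall x y, d (T x) (T y) = d x y) ->
  forall x y, p x = p y -> d x y = 0.
Proof.
move=> [[x0 _] Xc Tc Ts] [_ pmax] dcts dT x y pxy.
pose Q (u : psd_quotient d) : psd_quotient d := psd_class d (T (val u)).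
have Qclass z : Q (psd_class d z) = psd_class d (T z).
  by apply/psd_class_eq; rewrite dT psd_sym psd_repr_dist.
have Qiso u v : mdist (Q u) (Q v) = mdist u v :> R.
  by rewrite -{2}(psd_class_val u) -{2}(psd_class_val v) !mdist_class dT.
have class_cts : continuous (psd_class d).
  move=> z; apply/metricType_numDomainType.cvgrPdist_lt => e e0.
  by have := dcts z e e0; apply: filterS => w; rewrite mdist_class.
have class_surj : range (psd_class d) = [set: psd_quotient d].
  by apply/seteqP; split => // u _; exists (val u) => //; exact: psd_class_val.
have Qiso_iter n u v : mdist (iter n Q u) (iter n Q v) = mdist u v :> R.
  by elim: n => //= n; rewrite Qiso.
have Qfactor : equicontinuous_factor T Q (psd_class d).
  split.
  - split.
    + by exists (psd_class d x0).
    + rewrite -class_surj; apply: continuous_compact => //.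
      exact: continuous_subspaceT.
    + exact: isometry_continuous.
    + apply/seteqP; split => // u _.
      have : [set: X] (val u) by [].
      rewrite -Ts => -[z _ Tzu]; exists (psd_class d z) => //.
      by rewrite Qclass Tzu psd_class_val.
  - move=> e e0; exists e => // u v uv n _.
    by rewrite Qiso_iter.
  - by split => //; apply/funext => z /=; rewrite Qclass.
have [r _ qE] := pmax _ _ _ Qfactor.
by apply/(psd_class_eq d); rewrite qE /= pxy.
Qed.

(** * Fibres of the maximal equicontinuous factor *)

Section square_orbit_closure.
Context {R : realType} {X : metricType R}.

Definition square_orbit_closure (T : X -> X) (U : set X) : set (X * X) :=
  closure [set z | exists n u v,
    [/\ U u, U v & z = (iter n T u, iter n T v)]].

Lemma square_orbit_closure_invariant (T : X -> X) (U : set X) x y :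
  continuous T -> square_orbit_closure T U (x, y) ->
  square_orbit_closure T U (T x, T y).
Proof.
move=> Tc xyN B TxyB.
have /xyN[_ [[n [u [v [Uu Uv ->]]]] /= TB]] :
    nbhs (x, y) [set z | B (T z.1, T z.2)].
  have TTc : (T z.1, T z.2) @[z --> (x, y)] --> (T x, T y).
    by apply: cvg_pair; [apply: (continuous_comp cvg_fst) |
      apply: (continuous_comp cvg_snd)]; exact: Tc.
  exact: TTc.
by exists (iter n.+1 T u, iter n.+1 T v); split => //; exists n.+1, u, v.
Qed.

(** If [y] were outside the fibre of [x], so would be a closed neighbourhood
    [closure B] of [y].  With [y] the [k]-th iterate of a point of [U], the part
    of [U] sent into [B] gives a closed set [K] of positive content in the fibre
    of [y] and disjoint from that of [x], though the two fibres are at distance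
    zero. *)
Lemma fiber_pair_in_square_orbit_closure (T : X -> X) (Y : metricType R)
    (S : Y -> Y) (p : X -> Y) (U : set X) (x y : X) :
  minimal_system T -> maximal_equicontinuous_factor T S p ->
  open U -> U !=set0 -> p x = p y -> square_orbit_closure T U (x, y).
Proof.
move=> Tmin pmax Uo U0 pxy; have [[_ Xc Tc _] _] := Tmin.
have [m mT] := invariant_charge_exists R T x.
set N := square_orbit_closure T U.
have Ncl : closed N by exact: closed_closure.
have NT u v : N (u, v) -> N (T u, T v).
  exact: square_orbit_closure_invariant.
pose d := Pseudodistance (@fiber_distxx R X m N) (fiber_dist_sym Tmin mT Ncl NT)
  (fiber_dist_triangle Tmin mT Ncl NT).
have dyx : @fiber_dist R X m N y x = 0.
  apply: (@maximal_factor_collapses _ _ _ _ _ _ d Tmin.1 pmax) => //.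
    exact: (fiber_dist_continuous Tmin mT Ncl).
  exact: (fiber_dist_shift Tmin mT Ncl NT).
have [u [k [Uu Tky]]] := minimal_backward_orbit_meets Tmin y Uo U0.
have Tkc : continuous (iter k T) by exact: continuous_iter.
apply: contrapT => nNxy.
have /(_ (~` [set z | N (x, z)])) := @uniform_regular X y.
case=> [|B Bnbhs BN].
  apply: open_nbhs_nbhs; split => //; apply: closed_openC.
  exact: closed_fiber.
pose A := U `&` iter k T @^-1` B°.
have Ao : open A.
  by apply: openI => //; apply: open_comp (open_interior B) => z _; exact: Tkc.
have Au : A u by split => //; rewrite /= Tky.
pose K := iter k T @` closure A.
have Kcl : closed K.
  apply: compact_closed; first exact: metric_hausdorff.
  apply: continuous_compact; first exact: continuous_subspaceT.
  by apply: subclosed_compact Xc _ => //; exact: closed_closure.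
have K_sub (C : set X) : closed C -> A `<=` iter k T @^-1` C -> K `<=` C.
  move=> Ccl AC _ [z Az <-].
  have Ccl' : closed (iter k T @^-1` C) by apply: preimage_closed Ccl => w _.
  by have := closureS AC Az; rewrite -((closure_id _).1 Ccl').
have KN : K `<=` [set z | N (y, z)].
  apply: K_sub (closed_fiber (x := y) Ncl) _ => a [Ua _]; apply: subset_closure.
  by exists k, u, a; rewrite Tky.
have KB : K `<=` closure B.
  apply: K_sub (@closed_closure _ B) _ => a [_ /interior_subset Ba].
  exact: subset_closure.
(* The [k]-th iterate need not be open, but invariance bounds the content of its
   image [K] below by the charge of the open set [A]. *)
have mK : 0 < outer_charge m K.
  apply: lt_le_trans (minimal_charge_open_gt0 Tmin mT Ao _) _.
    by exists u.
  apply: outer_charge_ge => O Oo KO.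
  rewrite -(charge_iter_preimage mT k O); apply: (le_charge mT) => a Aa.
  by apply: KO; exists a => //; exact: subset_closure.
have [z [Kz]] := fiber_dist0_meet Tmin mT Ncl NT dyx Kcl KN mK.
exact/BN/KB.
Qed.
End square_orbit_closure.

(** * Broken sensitivity and asymptotic extensions *)

(** The sets [C l] decrease and are closed and nonempty, so they have a common
    point: a pair in one fibre of [p] that stays apart along all of [F]. *)
Lemma broken_sensitive_not_asymptotic (R : realType) (X Y : metricType R)
    (T : X -> X) (S : Y -> Y) (p : X -> Y) :
  is_system T -> equicontinuous_factor T S p ->
  broken_sensitive T infinite_family -> ~ asymptotic_extension T p.
Proof.
move=> [[x0 _] Xc Tc _] [_ Sequi [pc _ pTS]].
move=> [delta [F [delta0 Finf sens]]] asym.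
have p_iter n x : p (iter n T x) = iter n S (p x).
  elim: n => //= n <-; exact: (congr1 (@^~ (iter n T x)) pTS).
pose C (l : nat) : set (X * X) := [set z |
  mdist (p z.1) (p z.2) <= l.+1%:R^-1 /\
  forall j, F j /\ (1 <= j <= l.+1)%N ->
    delta <= mdist (iter j T z.1) (iter j T z.2)].
have Cne l : exists z, C l z.
  have l0 : 0 < (l.+1%:R : R)^-1 by rewrite invr_gt0.
  have [e' e'0 Se] := Sequi _ l0.
  pose e := Num.min e' l.+1%:R^-1.
  have e0 : 0 < e by rewrite lt_min e'0.
  pose U := (fun x => mdist (p x0) (p x) : R) @^-1` [set t | t < e / 2].
  have Uo : open U.
    apply: open_comp; [move=> x _|exact: open_lt].
    by apply: continuous_mdist => // y; exact: cvg_cst.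
  have U0 : U !=set0 by exists x0; rewrite /U /= mdistxx divr_gt0.
  have [u [v [n [Uu Uv sep]]]] := sens U Uo U0 l.+1 isT.
  have : mdist (p u) (p v) < e.
    apply: le_lt_trans (metric_triangle _ (p x0) _) _.
    by rewrite [e]splitr ltrD// metric_sym.
  rewrite lt_min => /andP[puve' puvl].
  exists (iter n T u, iter n T v); split => /=.
    (* Equicontinuity concerns positive times, whence the second bound in [e]. *)
    by case: n {sep} => [|n]; rewrite ltW// !p_iter Se.
  by move=> j [Fj jl]; rewrite -!iterD addnC ltW// sep.
have Ccl l : closed (C l).
  pose D (j : nat) : set (X * X) :=
    (fun z => mdist (iter j T z.1) (iter j T z.2) : R)
      @^-1` [set t | delta <= t].
  have -> : C l =
      ((fun z : X * X => mdist (p z.1) (p z.2) : R)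
        @^-1` [set t | t <= l.+1%:R^-1])
      `&` \bigcap_(j in [set j | F j /\ (1 <= j <= l.+1)%N]) D j by [].
  apply: closedI; last apply: closed_bigI => j _.
    apply: preimage_closed; [move=> z _|exact: closed_le].
    exact: continuous_mdist_pair.
  apply: preimage_closed; [move=> z _|exact: closed_ge].
  by apply: continuous_mdist_pair; exact: continuous_iter.
have Cdecr l l' : (l <= l')%N -> C l' `<=` C l.
  move=> ll' z [pz sep]; split.
    by apply: le_trans pz _; rewrite lef_pV2 ?posrE ?ltr0n// ler_nat.
  move=> j [Fj /andP[j1 jl]]; apply: sep; split => //.
  by rewrite j1 (leq_trans jl).
have XXc : compact [set: X * X] by rewrite -setXTT; exact: compact_setX.
have [z _ zC] : exists2 z : X * X, True & forall l, C l z.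
  have [c cC] := choice Cne.
  have [z [_ zcl]] := XXc (c n @[n --> \oo]) _ filterT.
  exists z => // l; rewrite ((closure_id _).1 (Ccl l)) => B /zcl; apply.
  by exists l => // l' /= ll'; exact: (Cdecr _ _ ll' _ (cC l')).
have /asym/cvgrPdist_lt /(_ delta delta0) [n _ near0] : p z.1 = p z.2.
  apply: (@mdist_positivity R); apply/le_anti; rewrite mdist_ge0 andbT.
  apply/ler_addgt0Pl => e e0; rewrite addr0.
  have [l _ /(_ l (leqnn l))] := near_infty_natSinv_lt (PosNum e0).
  by move=> /ltW; apply: le_trans; case: (zC l).
have [j Fj nj] : exists2 j, F j & (n < j)%N.
  apply: contrapT => /forall2NP nF; apply: Finf.
  apply: (@sub_finite_set _ _ `I_n.+1); last exact: finite_II.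
  by move=> j Fj; have [//|/negP] := nF j; rewrite -leqNgt.
have [_ /(_ j)] := zC j.
rewrite (leq_trans _ nj)// leqnSn => /(_ (conj Fj isT)).
have := near0 j (ltnW nj); rewrite /= sub0r normrN ger0_norm ?mdist_ge0//.
by rewrite ltNge => /negP.
Qed.

(** [F] collects the times at which a non-asymptotic pair of one fibre of [p] is
    [e]-apart; finitely many of these conditions define a neighbourhood of the
    pair, and some iterate of a pair from [U] enters it. *)
Lemma not_asymptotic_broken_sensitive (R : realType) (X Y : metricType R)
    (T : X -> X) (S : Y -> Y) (p : X -> Y) :
  minimal_system T -> maximal_equicontinuous_factor T S p ->
  ~ asymptotic_extension T p -> broken_sensitive T infinite_family.
Proof.
move=> Tmin pmax /existsNP[x1 /existsNP[x2 /not_implyP[px12 nasym]]].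
have [e e0 efar] : exists2 e : R, 0 < e &
    forall n, exists2 k, (n <= k)%N & e < mdist (iter k T x1) (iter k T x2).
  apply: contrapT => /forall2NP near0; apply: nasym.
  apply/cvgrPdist_lt => e e0.
  have [//|] := near0 (e / 2); first by rewrite divr_gt0.
  move=> /existsNP[n /forall2NP nP]; exists n => // k /= nk.
  rewrite sub0r normrN ger0_norm ?mdist_ge0//.
  have [//|/negP] := nP k; rewrite -leNgt => /le_lt_trans; apply.
  by rewrite ltr_pdivrMr// ltr_pMr// ltr1n.
pose F := [set k | e < mdist (iter k T x1) (iter k T x2)].
exists e, F; split => //.
  move=> /finite_seqP[s Fs]; have [k ks Fk] := efar (\max_(i <- s) i).+1.
  have : F k by [].
  rewrite Fs /= => ks'; have := @leq_bigmax_seq _ s xpredT id k ks' isT.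
  by rewrite leqNgt ks.
move=> U Uo U0 l _.
have := fiber_pair_in_square_orbit_closure Tmin pmax Uo U0 px12.
pose V n := [set z : X * X | forall j, (j < n)%N -> F j ->
  e < mdist (iter j T z.1) (iter j T z.2)].
have Tc : continuous T by case: Tmin => -[].
have Vnbhs n : nbhs (x1, x2) (V n).
  elim: n => [|n IHn]; first exact: filterE.
  have [Fn|nFn] := pselect (F n); last first.
    apply: filterS IHn => z Vz j; rewrite ltnS leq_eqVlt => /predU1P[->//|].
    exact: Vz.
  have dist_cts :
      continuous (fun z : X * X => mdist (iter n T z.1) (iter n T z.2) : R).
    by apply: continuous_mdist_pair; exact: continuous_iter.
  have sep := cvgr_gt _ (dist_cts (x1, x2)) _ Fn.
  apply: filterS2 IHn (sep _) => z Vz zn j.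
  rewrite ltnS leq_eqVlt => /predU1P[->//|]; exact: Vz.
move=> /(_ _ (Vnbhs l.+1))[_ [[m [u [v [Uu Uv ->]]]] Vuv]].
exists u, v, m; split => // j Fj /andP[_ jl].
by rewrite addnC !iterD; exact: (Vuv j).
Qed.

Theorem proposition3p13 (R : realType) (X : metricType R) (T : X -> X)
    (Xeq : metricType R) (Teq : Xeq -> Xeq) (p : X -> Xeq)
    (hmin : minimal_system T)
    (hmef : maximal_equicontinuous_factor T Teq p) :
  broken_sensitive T infinite_family <-> ~ asymptotic_extension T p.
Proof.
split; last exact: not_asymptotic_broken_sensitive hmin hmef.
exact: broken_sensitive_not_asymptotic hmin.1 hmef.1.
Qed.
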